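(* Let $\mathcal{P}\subseteq\mathbb{R}^D$ have linear span equal to $\mathbb{R}^D$. For every ALPV $\Sigma$ with scheduling space $\mathcal{P}$ let $\mathfrak{S}(\Sigma)$ be its associated linear switched system, and for every $f:\mathcal{U}^+\to\mathbb{R}^r$ admitting a GCR let $\mathfrak{I}(f)$ be its associated switched input-output map. Then: 1. An ALPV $\Sigma$ is a realization of an input-output map $f$ (admitting a GCR) if and only if $\mathfrak{S}(\Sigma)$ is a realization of $\mathfrak{I}(f)$. 2. For any ALPV $\Sigma$, $\dim\mathfrak{S}(\Sigma)=\dim\Sigma$. 3. Two ALPVs $\Sigma_1$ and $\Sigma_2$ are isomorphic if and only if $\mathfrak{S}(\Sigma_1)$ is isomorphic to $\mathfrak{S}(\Sigma_2)$. 4. An ALPV $\Sigma$ is reachable, observable, or minimal if and only if $\mathfrak{S}(\Sigma)$ is, respectively, reachable, observable, or minimal.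
   Context: Fix positive integers $D,m,r$, put $Q=\{1,\dots,D\}$. For a set $X$, $X^+$ denotes the set of finite non-empty sequences of elements of $X$, and $|v|$ the length of a sequence $v$. $\mathbb{N}$ contains $0$. ALPV. For a set $\mathcal{P}\subseteq\mathbb{R}^D$ (scheduling space), a discrete-time affine LPV system (ALPV) $\Sigma=(r,m,n,\mathcal{P},\{(A_q,B_q,C_q)\}_{q=1}^D)$ consists of $n\in\mathbb{N}$ and matrices $A_q\in\mathbb{R}^{n\times n}$, $B_q\in\mathbb{R}^{n\times m}$, $C_q\in\mathbb{R}^{r\times n}$, $q\in Q$, and has dynamics $$x(t+1)=\sum_{q=1}^D (A_qx(t)+B_qu(t))p_q(t),\qquad y(t)=\sum_{q=1}^D C_qx(t)p_q(t),$$ with $p(t)=(p_1(t),\dots,p_D(t))\in\mathcal{P}$, $u(t)\in\mathbb{R}^m$. Its dimension is $\dim\Sigma=n$. Let $\mathcal{U}=\mathcal{P}\times\mathbb{R}^m$. For $x\in\mathbb{R}^n$ and $w=(p(0),u(0))\cdots(p(t),u(t))\in\mathcal{U}^+$, $x_{\Sigma,x}(w)$ and $y_{\Sigma,x}(w)$ denote the state $x(t)$ and output $y(t)$ at time $t$ when $x(0)=x$ and the scheduling values and inputs in $w$ are applied. The input-output map of $\Sigma$ is $y_\Sigma=y_{\Sigma,0}$. An input-output map is a map $f:\mathcal{U}^+\to\mathbb{R}^r$; $\Sigma$ is a realization of $f$ if $f=y_\Sigma$. $\Sigma$ is reachable if $\{x_{\Sigma,0}(w): w\in\mathcal{U}^+\}$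 spans $\mathbb{R}^n$; observable if $y_{\Sigma,x_1}=y_{\Sigma,x_2}$ implies $x_1=x_2$; minimal if $\dim\Sigma\le\dim\hat\Sigma$ for every ALPV $\hat\Sigma$ (with the same $r,m,\mathcal{P}$) which is a realization of $y_\Sigma$. Two ALPVs $(r,m,n,\mathcal{P},\{(A_q,B_q,C_q)\})$ and $(r,m,n,\mathcal{P},\{(A_q^a,B_q^a,C_q^a)\})$ are isomorphic if there is a nonsingular constant $\mathcal{S}\in\mathbb{R}^{n\times n}$ with $A_q^a\mathcal{S}=\mathcal{S}A_q$, $B_q^a=\mathcal{S}B_q$, $C_q^a\mathcal{S}=C_q$ for all $q\in Q$. GCR. $f:\mathcal{U}^+\to\mathbb{R}^r$ has a generalized convolution representation (GCR) if there is a map $S^f:\{v\in Q^+:|v|>1\}\to\mathbb{R}^{r\times m}$ such that for every $w=(p(0),u(0))\cdots(p(t),u(t))\in\mathcal{U}^+$ $$f(w)=\sum_{k=0}^{t-1}\Big\{\sum_{v\in Q^+,|v|=t-k+1}S^f(v)\,\underline{p}_{k:t}^{v}\Big\}u(k),$$ where for $v=q_0\cdots q_{t-k}$, $\underline{p}_{k:t}^{v}=p_{q_0}(k)p_{q_1}(k+1)\cdots p_{q_{t-k}}(t)$. When $\mathcal{P}$ spans $\mathbb{R}^D$, $S^f$ is uniquely determined by $f$, and $f$ has a unique extension $f_{ext}$ to $(\mathbb{R}^D\times\mathbb{R}^m)^+$ admitting a GCR with $S^{f_{ext}}=S^f$ (given by the same formula). Switched systems. Let $\mathcal{P}_{sw}=\{e_1,\dots,e_D\}$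 (standard basis vectors of $\mathbb{R}^D$), $\mathcal{U}_{sw}=\mathcal{P}_{sw}\times\mathbb{R}^m$. A linear switched system is an ALPV with scheduling space $\mathcal{P}_{sw}$ (identifying $e_q$ with the discrete mode $q$); realization, dimension, isomorphism, reachability, observability and minimality of linear switched systems are the notions above with $\mathcal{P}=\mathcal{P}_{sw}$ (minimality thus being relative to linear switched systems). For $f$ admitting a GCR, $\mathfrak{I}(f):\mathcal{U}_{sw}^+\to\mathbb{R}^r$ is the restriction of $f_{ext}$ to $\mathcal{U}_{sw}^+$. For an ALPV $\Sigma=(r,m,n,\mathcal{P},\{(A_q,B_q,C_q)\}_{q=1}^D)$, $\mathfrak{S}(\Sigma)=(r,m,n,\mathcal{P}_{sw},\{(A_q,B_q,C_q)\}_{q=1}^D)$. *)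

(* Defs.v *)
From mathcomp Require Import all_boot all_order all_algebra.
From mathcomp Require Import all_classical all_reals.

Set Implicit Arguments.
Unset Strict Implicit.
Unset Printing Implicit Defensive.

Import GRing.Theory.
Local Open Scope classical_set_scope.
Local Open Scope ring_scope.

Definition linspan (K : fieldType) (V : vectType K) (X : set V) : set V :=
  [set v | exists2 s : seq V, [set` s] `<=` X & v \in <<s>>%VS].

Definition nonempty_words (T : eqType) (X : set T) : set (seq T) :=
  [set w | w != [::] /\ [set` w] `<=` X].

Lemma nonempty_words_subset (T : eqType) (X Y : set T) :
  X `<=` Y -> nonempty_words X `<=` nonempty_words Y.
Proof. by move=> XY w [w0 wX]; split=> // x /wX /XY. Qed.

Definition restrict_dom (T U : Type) (A B : set T) (AB : A `<=` B)
  (f : B -> U) : A -> U :=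
  fun x => f (exist _ (val x) (mem_set (AB _ (set_mem (valP x))))).

Section ALPV.
Variables (R : realType) (D m r : nat).

(* The index q in {1, ..., D} is rendered as q : 'I_D. *)

Definition inputs (P : set 'cV[R]_D) : set ('cV[R]_D * 'cV[R]_m) :=
  P `*` setT.

Lemma inputs_subset (P P' : set 'cV[R]_D) :
  P `<=` P' -> inputs P `<=` inputs P'.
Proof. by move=> PP' z [/PP' Pz _]. Qed.

(* For w = (p(0),u(0)) ... (p(t),u(t)): t, p(k) and u(k).  Out of range
   indices give 0 but are never used below. *)
Definition last_time (w : seq ('cV[R]_D * 'cV[R]_m)) : nat := (size w).-1.
Definition sched (w : seq ('cV[R]_D * 'cV[R]_m)) (k : nat) : 'cV[R]_D :=
  (w`_k).1.
Definition input (w : seq ('cV[R]_D * 'cV[R]_m)) (k : nat) : 'cV[R]_m :=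
  (w`_k).2.

Definition iomap (P : set 'cV[R]_D) : Type :=
  nonempty_words (inputs P) -> 'cV[R]_r.

(* The scheduling space P is part of the data of a system, although the
   matrices do not depend on it. *)
Record alpv (P : set 'cV[R]_D) := ALPV {
  alpv_dim : nat;
  Amx : 'I_D -> 'M[R]_alpv_dim;
  Bmx : 'I_D -> 'M[R]_(alpv_dim, m);
  Cmx : 'I_D -> 'M[R]_(r, alpv_dim) }.

Section System.
Variables (P : set 'cV[R]_D) (S : alpv P).

Fixpoint state_at (x0 : 'cV[R]_(alpv_dim S)) (p : nat -> 'cV[R]_D)
    (u : nat -> 'cV[R]_m) (t : nat) : 'cV[R]_(alpv_dim S) :=
  if t is t'.+1 then
    \sum_(q < D) p t' q 0 *: (Amx S q *m state_at x0 p u t' + Bmx S q *m u t')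
  else x0.

(* x_{S,x0}(w) is the state at the last time t of w, so it does not depend on
   the last letter of w. *)
Definition state (x0 : 'cV[R]_(alpv_dim S)) (w : nonempty_words (inputs P)) :
    'cV[R]_(alpv_dim S) :=
  state_at x0 (sched (val w)) (input (val w)) (last_time (val w)).

Definition output (x0 : 'cV[R]_(alpv_dim S)) : iomap P := fun w =>
  \sum_(q < D) sched (val w) (last_time (val w)) q 0 *: (Cmx S q *m state x0 w).

Definition io_map_of : iomap P := output 0.

Definition realizes (f : iomap P) : Prop := f = io_map_of.

Definition reachable : Prop := linspan (range (state 0)) = setT.

Definition observable : Prop :=
  forall x1 x2, output x1 = output x2 -> x1 = x2.

End System.

Definition minimal (P : set 'cV[R]_D) (S : alpv P) : Prop :=
  forall S' : alpv P, realizes S' (io_map_of S) -> (alpv_dim S <= alpv_dim S')%N.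

Inductive isomorphic (P : set 'cV[R]_D) : alpv P -> alpv P -> Prop :=
  Isomorphic (n : nat) (A Aa : 'I_D -> 'M[R]_n) (B Ba : 'I_D -> 'M[R]_(n, m))
    (C Ca : 'I_D -> 'M[R]_(r, n)) (T : 'M[R]_n) :
    T \in unitmx ->
    (forall q, [/\ Aa q *m T = T *m A q, Ba q = T *m B q & Ca q *m T = C q]) ->
    isomorphic (ALPV P A B C) (ALPV P Aa Ba Ca).

Definition gcr_kernel : Type :=
  {v : seq 'I_D | (1 < size v)%N} -> 'M[R]_(r, m).

Lemma size_gcr_word (t : nat) (k : 'I_t) (v : (t - k).+1.-tuple 'I_D) :
  (1 < size v)%N.
Proof. by rewrite size_tuple ltnS subn_gt0. Qed.

Definition sched_monomial (p : nat -> 'cV[R]_D) (k l : nat)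
    (v : l.-tuple 'I_D) : R :=
  \prod_(i < l) p (k + i)%N (tnth v i) 0.

Definition gcr_eval (K : gcr_kernel) (w : seq ('cV[R]_D * 'cV[R]_m)) :
    'cV[R]_r :=
  \sum_(k < last_time w)
    (\sum_(v : (last_time w - k).+1.-tuple 'I_D)
       sched_monomial (sched w) k v *: K (exist _ (val v) (size_gcr_word v)))
      *m input w k.

Definition is_gcr (P : set 'cV[R]_D) (f : iomap P) (K : gcr_kernel) : Prop :=
  forall w, f w = gcr_eval K (val w).

Definition admits_gcr (P : set 'cV[R]_D) (f : iomap P) : Prop :=
  exists K, is_gcr f K.

(* S^f: the representing kernel, unique when P spans R^D. *)
Definition kernel_of (P : set 'cV[R]_D) (f : iomap P) (fP : admits_gcr f) :
  gcr_kernel := sval (cid fP).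

Definition io_ext (P : set 'cV[R]_D) (f : iomap P) (fP : admits_gcr f) :
  iomap setT := fun w => gcr_eval (kernel_of fP) (val w).

Definition Psw : set 'cV[R]_D := range (fun q : 'I_D => delta_mx q 0).

Definition switched_io (P : set 'cV[R]_D) (f : iomap P)
    (fP : admits_gcr f) : iomap Psw :=
  restrict_dom (nonempty_words_subset (inputs_subset (@subsetT _ Psw))) (io_ext fP).

Definition switched (P : set 'cV[R]_D) (S : alpv P) : alpv Psw :=
  ALPV Psw (Amx S) (Bmx S) (Cmx S).

End ALPV.

(* Main.v *)
(** An input-output map with a GCR is multilinear in the scheduling values, so
  over a spanning scheduling space it determines its kernel; the zero-state
  response of a system has the Markov parameters C_q A_v B_q' as kernel.  Hence
  realizing a map amounts to an equality of kernels, which does not involve the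
  scheduling space, and minimality follows.  The span of the reachable states is
  the least subspace closed under the one-step maps, and the unobservable states
  form a subspace closed under the input-free ones; since these maps are linear
  in the scheduling value, closure for all values in P is the same as closure
  for all values in its span. *)

Require Import Defs.
From mathcomp Require Import all_boot all_order all_algebra.
From mathcomp Require Import all_classical all_reals.
Local Open Scope classical_set_scope.
Local Open Scope ring_scope.

Set Implicit Arguments.
Unset Strict Implicit.
Unset Printing Implicit Defensive.

Import GRing.Theory.

(** * Linear spans as least subspaces *)

Section LinearSpan.
Variables (K : fieldType) (V : vectType K).
Implicit Types (X W : set V).

Definition subspace W : Prop :=
  W 0 /\ forall a x y, W x -> W y -> W (a *: x + y).

Lemma subset_linspan X : X `<=` linspan X.
Proof.
move=> x Xx; exists [:: x]; last by rewrite memv_span ?mem_head.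
by move=> y /=; rewrite inE => /eqP ->.
Qed.

Lemma subspace_linspan X : subspace (linspan X).
Proof.
split=> [|a x y [s sX xs] [s' s'X ys']].
  by exists [::]; [move=> y /=; rewrite in_nil | rewrite mem0v].
exists (s ++ s').
  by move=> z /=; rewrite mem_cat => /orP[/sX|/s'X].
by rewrite span_cat memv_add ?memvZ.
Qed.

Lemma linspan_min X W : subspace W -> X `<=` W -> linspan X `<=` W.
Proof.
move=> [W0 Wlin] XW v [s sX vs].
rewrite (coord_span (X := in_tuple s) vs).
elim/big_ind: _ => [|x y Wx Wy|i _]; first exact: W0.
  by rewrite -[x]scale1r; exact: Wlin.
rewrite -[_ *: _]addr0; apply: Wlin => //; apply/XW/sX.
by rewrite /= mem_nth.
Qed.

Lemma linspan_ind X W : linspan X = setT -> subspace W -> X `<=` W ->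
  forall x, W x.
Proof. by move=> XT Wsub XW x; apply: (linspan_min Wsub XW); rewrite XT. Qed.

End LinearSpan.

Lemma linspan_Psw (R : realType) (D : nat) : linspan (@Psw R D) = setT.
Proof.
apply/seteqP; split=> // v _; exists [seq delta_mx q 0 | q <- enum 'I_D].
  by move=> _ /= /mapP[q _ ->]; exists q.
rewrite [v]matrix_sum_delta; apply: memv_suml => q _.
rewrite big_ord1; apply/memvZ/memv_span/mapP.
by exists q; rewrite ?mem_enum.
Qed.

(** * Multilinear sums over words of modes *)

Section TupleSums.
Variables (R : realType) (D : nat).
Implicit Types (p : nat -> 'cV[R]_D).

Lemma rcons_tuple_bij (T : Type) (l : nat) :
  bijective (fun vq : l.-tuple T * T => [tuple of rcons vq.1 vq.2]).
Proof.
pose g (v : l.+1.-tuple T) : l.-tuple T * T :=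
  ([tuple of belast (thead v) (behead v)], last (thead v) (behead v)).
exists g.
  case=> v q; rewrite /g; congr pair.
    apply: val_inj => /=.
    by case: v => -[|a s] //= sz; rewrite /thead (tnth_nth a) /= belast_rcons.
  by case: v => -[|a s] //= sz; rewrite /thead (tnth_nth q) //= last_rcons.
move=> v; apply: val_inj; rewrite /= -lastI.
by case/tupleP: v => a s; rewrite theadE.
Qed.

Lemma sched_monomial_rcons p k l (v : l.-tuple 'I_D) q :
  sched_monomial p k [tuple of rcons v q] =
  sched_monomial p k v * p (k + l)%N q 0.
Proof.
rewrite /sched_monomial big_ord_recr /=; congr (_ * _).
  apply: eq_bigr => i _; congr (p _ _ _).
  by rewrite !(tnth_nth q) /= nth_rcons size_tuple ltn_ord.
by rewrite (tnth_nth q) /= nth_rcons size_tuple ltnn eqxx.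
Qed.

(** The last letter carries the latest scheduling value, so splitting it off matches one step of the
    state recursion or the final readout. *)
Lemma sum_rcons_monomial (V : lmodType R) p k l (F : seq 'I_D -> V) :
  \sum_(v : l.+1.-tuple 'I_D) sched_monomial p k v *: F v =
  \sum_q p (k + l)%N q 0 *:
    \sum_(v : l.-tuple 'I_D) sched_monomial p k v *: F (rcons v q).
Proof.
rewrite (reindex _ (onW_bij _ (rcons_tuple_bij _ l))) /=.
rewrite -(pair_bigA _ (fun (v : l.-tuple 'I_D) (q : 'I_D) =>
  sched_monomial p k [tuple of rcons v q] *: F (rcons v q))) /=.
rewrite exchange_big; apply: eq_bigr => q _; rewrite scaler_sumr.
by apply: eq_bigr => v _; rewrite sched_monomial_rcons scalerA mulrC.
Qed.

Lemma eq_sched_monomial p p' k l (v : l.-tuple 'I_D) :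
  (forall i, (i < l)%N -> p (k + i)%N = p' (k + i)%N) ->
  sched_monomial p k v = sched_monomial p' k v.
Proof. by move=> pp'; apply: eq_bigr => i _; rewrite pp'. Qed.

Definition update p (j : nat) (x : 'cV[R]_D) : nat -> 'cV[R]_D :=
  fun i => if i == j then x else p i.

Lemma sched_monomial_update p l (v : l.-tuple 'I_D) j (jl : (j < l)%N) x :
  sched_monomial (update p j x) 0 v = x (tnth v (Ordinal jl)) 0 *
    \prod_(i < l | i != Ordinal jl) p i (tnth v i) 0.
Proof.
rewrite /sched_monomial (bigD1 (Ordinal jl)) //= /update add0n eqxx.
congr (_ * _); apply: eq_bigr => i ij.
by rewrite add0n (negPf (_ : i != j :> nat)).
Qed.

Lemma sched_monomial_delta l (v v' : l.-tuple 'I_D) p :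
  (forall i : 'I_l, p i = delta_mx (tnth v i) 0) ->
  sched_monomial p 0 v' = (v' == v)%:R.
Proof.
move=> pE; rewrite /sched_monomial; have [->|vv'] := eqVneq v' v.
  by rewrite big1 // => i _; rewrite add0n pE mxE !eqxx.
have [i vi] : exists i, tnth v' i != tnth v i.
  apply/existsP; rewrite -negb_forall; apply: contra vv' => /forallP v'v.
  by apply/eqP/eq_from_tnth => i; apply/eqP.
by rewrite (bigD1 i) //= add0n pE mxE (negPf vi) mul0r.
Qed.

(* A multilinear form vanishing on P x ... x P vanishes on the product of the
   spans, as seen by freeing one argument after the other; evaluation at basis
   vectors then recovers its coefficients. *)
Lemma monomial_coef_eq0 (V : lmodType R) (P : set 'cV[R]_D) l
    (F : l.-tuple 'I_D -> V) : linspan P = setT ->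
  (forall p, (forall i, (i < l)%N -> P (p i)) ->
     \sum_v sched_monomial p 0 v *: F v = 0) ->
  forall v, F v = 0.
Proof.
move=> PT F0 v.
have F0j j : (j <= l)%N -> forall p,
    (forall i, (j <= i < l)%N -> P (p i)) ->
    \sum_v sched_monomial p 0 v *: F v = 0.
  elim: j => [|j IHj] jl p pP; first exact: F0.
  pose W x := \sum_v sched_monomial (update p j x) 0 v *: F v = 0.
  have W_all x : W x.
    apply: (linspan_ind PT (W := W)) => [|{}x Px]; last first.
      apply: IHj => [|i /andP[ji il]]; first exact: ltnW.
      rewrite /update; case: eqVneq => // ij; apply: pP.
      by rewrite il ltn_neqAle eq_sym ij ji.
    (* The update touches one factor only; [c w] gathers the others, so the sum is linear in the
       freed value. *)
    pose c w := \prod_(i < l | i != Ordinal jl) p i (tnth w i) 0.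
    have WE y : W y <->
        \sum_w y (tnth w (Ordinal jl)) 0 *: (c w *: F w) = 0.
      by rewrite /W; under eq_bigr do rewrite sched_monomial_update -scalerA.
    split=> [|a y z /WE Wy /WE Wz]; apply/WE.
      by rewrite big1 // => w _; rewrite mxE scale0r.
    under eq_bigr do rewrite !mxE scalerDl -scalerA.
    by rewrite big_split /= -scaler_sumr Wy Wz scaler0 addr0.
  rewrite -[RHS](W_all (p j)); apply: eq_bigr => w _; congr (_ *: _).
  by apply: eq_sched_monomial => i _; rewrite /update; case: eqP => [->|].
pose p i : 'cV[R]_D :=
  if insub i is Some o then delta_mx (tnth v (o : 'I_l)) 0 else 0.
have pE (i : 'I_l) : p i = delta_mx (tnth v i) 0 by rewrite /p valK.
have := F0j _ (leqnn _) p; rewrite (bigD1 v) //= big1 => [|w wv].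
  rewrite (sched_monomial_delta _ pE) eqxx scale1r addr0; apply=> i.
  by case: leqP.
by rewrite (sched_monomial_delta _ pE) (negPf wv) scale0r.
Qed.

End TupleSums.

(** * Words versus infinite signals *)

Section Words.
Variables (R : realType) (D m : nat).
Implicit Types (P : set 'cV[R]_D).

Lemma word_of_signals P (p : nat -> 'cV[R]_D) (u : nat -> 'cV[R]_m) t :
  (forall i, P (p i)) ->
  exists w : nonempty_words (inputs (m := m) P), [/\ last_time (val w) = t,
    forall i, (i <= t)%N -> sched (val w) i = p i &
    forall i, (i <= t)%N -> input (val w) i = u i].
Proof.
move=> pP; pose s := mkseq (fun i => (p i, u i)) t.+1.
have sP : nonempty_words (inputs P) s 
  by split=> // _ /= /mapP[i _ ->]; split=> //; exact: pP.
pose w : nonempty_words (inputs P) := exist _ s (mem_set sP).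
have ws : val w = mkseq (fun i => (p i, u i)) t.+1 by [].
exists w; split=> [|i it|i it]; rewrite /last_time /sched /input ws.
- by rewrite size_mkseq.
- by rewrite nth_mkseq.
- by rewrite nth_mkseq.
Qed.

Lemma signals_of_word P (w : nonempty_words (inputs (m := m) P)) :
  exists2 p, forall i, P (p i) &
    forall i, (i <= last_time (val w))%N -> sched (val w) i = p i.
Proof.
have [w0 wP] := set_mem (valP w).
(* Freezing the signal after the last time keeps it in [P], whereas the default 0 of out-of-range
   indices may lie outside [P]. *)
exists (fun i => sched (val w) (minn i (last_time (val w)))) => i; last first.
  by move/minn_idPl ->.
suff /wP[] : [set` val w] (val w)`_(minn i (last_time (val w))) by [].
rewrite /= mem_nth // (leq_ltn_trans (geq_minr _ _)) // ltn_predL.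
by rewrite lt0n size_eq0; exact: w0.
Qed.

End Words.

(** * Uniqueness of the convolution kernel *)

Section Kernels.
Variables (R : realType) (D m r : nat).
Implicit Types (P : set 'cV[R]_D) (K : gcr_kernel R D m r).

(** Extension by 0 to all words removes the length proofs from sums over tuples. *)
Definition kernel_seq K (s : seq 'I_D) : 'M[R]_(r, m) :=
  if insub s is Some v then K v else 0.

Lemma kernel_seqE K v : kernel_seq K (val v) = K v.
Proof. by rewrite /kernel_seq valK. Qed.

Lemma gcr_evalE K w : gcr_eval K w = \sum_(k < last_time w)
  (\sum_(v : (last_time w - k).+1.-tuple 'I_D)
     sched_monomial (sched w) k v *: kernel_seq K v) *m input w k.
Proof.
apply: eq_bigr => k _; congr (_ *m _); apply: eq_bigr => v _.
by rewrite -kernel_seqE.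
Qed.

(** Only the term [k = 0] survives; the input at the last time [t.+1] never enters the sum, so it is
    left free. *)
Lemma gcr_eval_impulse K w t : last_time w = t.+1 ->
  (forall i, (0 < i <= t)%N -> input w i = 0) ->
  gcr_eval K w =
  (\sum_(v : t.+2.-tuple 'I_D) sched_monomial (sched w) 0 v *: kernel_seq K v)
    *m input w 0.
Proof.
move=> wt w0; rewrite gcr_evalE wt big_ord_recl [X in _ + X]big1 => [|k _].
  by rewrite addr0 subn0.
by rewrite w0 ?mulmx0 // lift0 /= ltn_ord.
Qed.

Lemma is_gcr_inj P (f : iomap m r P) K K' : linspan P = setT ->
  is_gcr f K -> is_gcr f K' -> K = K'.
Proof.
move=> PT fK fK'.
have KK' t (v : t.+2.-tuple 'I_D) : kernel_seq K v = kernel_seq K' v.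
  (* Column [j] is isolated by an impulse along the [j]-th input direction at time 0; what remains
     is a multilinear form in the scheduling values. *)
  apply/eqP; rewrite -subr_eq0; apply/eqP/matrixP => i j.
  suff /colP/(_ i) : (kernel_seq K v - kernel_seq K' v) *m delta_mx j 0 =
    0 :> 'cV[R]_r by rewrite -colE !mxE.
  move: v; apply: (monomial_coef_eq0 PT) => p pP.
  (* [p] is known to lie in [P] only up to time [t.+1], so it is frozen from there on. *)
  have p'P i' : P (p (minn i' t.+1)) by apply: pP; rewrite ltnS geq_minr.
  have [w [wt wp wu]] := word_of_signals
    (fun i => if i is 0%N then delta_mx j 0 else 0 : 'cV[R]_m) t.+1 p'P.
  have u0 i' : (0 < i' <= t)%N -> input (val w) i' = 0.
    by case: i' => // i' /ltnW it; rewrite wu.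
  have := fK' w; rewrite fK !(gcr_eval_impulse _ wt u0) wu // => /eqP.
  rewrite -subr_eq0 -mulmxBl -sumrB mulmx_suml => /eqP w0; rewrite -[RHS]w0.
  apply: eq_bigr => v _; rewrite -scalerBr -scalemxAl; congr (_ *: _).
  apply: eq_sched_monomial => i' it; rewrite add0n wp //.
  by rewrite (minn_idPl _).
apply: funext => -[s s_gt1]; rewrite -!kernel_seqE /=.
case: s s_gt1 => // q0 [//|q1 s] _.
exact: (KK' _ (in_tuple (q0 :: q1 :: s))).
Qed.

End Kernels.

(** * Responses, Markov parameters, reachable and unobservable states *)

Section Responses.
Variables (R : realType) (D m r : nat) (P : set 'cV[R]_D) (S : alpv m r P).
Local Notation n := (alpv_dim S).
Implicit Types (p : nat -> 'cV[R]_D) (u : nat -> 'cV[R]_m) (x : 'cV[R]_n).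

Definition step (a : 'cV[R]_D) x (b : 'cV[R]_m) : 'cV[R]_n :=
  \sum_(q < D) a q 0 *: (Amx S q *m x + Bmx S q *m b).

Definition readout (a : 'cV[R]_D) x : 'cV[R]_r :=
  \sum_(q < D) a q 0 *: (Cmx S q *m x).

Lemma step_sched_linear c a a' x b :
  step (c *: a + a') x b = c *: step a x b + step a' x b.
Proof.
rewrite /step scaler_sumr -big_split; apply: eq_bigr => q _ /=.
by rewrite !mxE scalerDl scalerA.
Qed.

Lemma step_linear c a x x' b b' :
  step a (c *: x + x') (c *: b + b') = c *: step a x b + step a x' b'.
Proof.
rewrite /step scaler_sumr -big_split; apply: eq_bigr => q _ /=.
rewrite !mulmxDr -!scalemxAr addrACA scalerDr.
by rewrite -[c *: _ + _]scalerDr !scalerA mulrC.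
Qed.

Lemma readout_sched_linear c a a' x :
  readout (c *: a + a') x = c *: readout a x + readout a' x.
Proof.
rewrite /readout scaler_sumr -big_split; apply: eq_bigr => q _ /=.
by rewrite !mxE scalerDl scalerA.
Qed.

Lemma readout_linear c a x x' :
  readout a (c *: x + x') = c *: readout a x + readout a x'.
Proof.
rewrite /readout scaler_sumr -big_split; apply: eq_bigr => q _ /=.
by rewrite mulmxDr -!scalemxAr scalerDr !scalerA mulrC.
Qed.

Lemma step0 x b : step 0 x b = 0.
Proof. by rewrite /step big1 // => q _; rewrite mxE scale0r. Qed.

Lemma step00 a : step a 0 0 = 0.
Proof. by rewrite /step big1 // => q _; rewrite !mulmx0 addr0 scaler0. Qed.

Lemma readout0 x : readout 0 x = 0.
Proof. by rewrite /readout big1 // => q _; rewrite mxE scale0r. Qed.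

Lemma eq_state_at x p p' u u' t :
  (forall i, (i < t)%N -> p i = p' i) ->
  (forall i, (i < t)%N -> u i = u' i) ->
  state_at x p u t = state_at x p' u' t.
Proof.
elim: t => //= t IHt pp' uu'.
by rewrite pp' // uu' // IHt // => i it; rewrite ?pp' ?uu' // ltnW.
Qed.

Lemma state_at_linear c x x' p u u' t :
  state_at (c *: x + x') p (fun i => c *: u i + u' i) t =
  c *: state_at x p u t + state_at x' p u' t.
Proof. by elim: t => //= t ->; apply: step_linear. Qed.

(** [state_at] recurses on the last instant; the argument on unobservable states peels off the first
    one instead. *)
Lemma state_at_shift x p u t :
  state_at x p u t.+1 =
  state_at (step (p 0%N) x (u 0%N)) (fun i => p i.+1) (fun i => u i.+1) t.
Proof. by elim: t => // t IHt; rewrite [LHS]/= -/(state_at x p u t.+1) IHt. Qed.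

Lemma range_stateP x : range (state 0) x <->
  exists p u t, (forall i, P (p i)) /\ x = state_at 0 p u t.
Proof.
split=> [[w _ <-]|[p [u [t [pP ->]]]]].
  have [p pP wp] := signals_of_word w.
  exists p, (input (val w)), (last_time (val w)); split=> //.
  by apply: eq_state_at => // i /ltnW; exact: wp.
have [w [wt wp wu]] := word_of_signals u t pP.
exists w => //; rewrite /state wt; apply: eq_state_at => i /ltnW.
  exact: wp.
exact: wu.
Qed.

Lemma output_eqP x x' : output x = output x' <->
  forall p u t, (forall i, P (p i)) ->
    readout (p t) (state_at x p u t) = readout (p t) (state_at x' p u t).
Proof.
have outE y w p u t : last_time (val w) = t ->
    (forall i, (i <= t)%N -> sched (val w) i = p i) ->
    (forall i, (i <= t)%N -> input (val w) i = u i) ->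
    output y w = readout (p t) (state_at y p u t).
  move=> wt wp wu; rewrite /output /state wt wp //.
  congr (readout _ _); apply: eq_state_at => i /ltnW; [exact: wp|exact: wu].
split=> [xx' p u t pP|xx'].
  have [w [wt wp wu]] := word_of_signals u t pP.
  by rewrite -!(outE _ w) // xx'.
apply: funext => w; have [p pP wp] := signals_of_word w.
by rewrite !(outE _ w p (input (val w)) _ erefl) // xx'.
Qed.

(* The Markov parameter A_{q_{l-1}} ... A_{q_1} B_{q_0} of the input-to-state
   map; words are read backwards because the last letter acts outermost. *)
Fixpoint state_markov_rev (s : seq 'I_D) : 'M[R]_(n, m) :=
  if s is q :: s' then
    if s' is [::] then Bmx S q else Amx S q *m state_markov_rev s'
  else 0.

Definition state_markov (s : seq 'I_D) : 'M[R]_(n, m) :=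
  state_markov_rev (rev s).

Definition markov_seq (s : seq 'I_D) : 'M[R]_(r, m) :=
  if rev s is q :: s' then Cmx S q *m state_markov_rev s' else 0.

Definition markov : gcr_kernel R D m r := fun v => markov_seq (val v).

Lemma state_markov_rcons s q : state_markov (rcons s q) =
  if s is [::] then Bmx S q else Amx S q *m state_markov s.
Proof.
rewrite /state_markov rev_rcons; case/lastP: s => // s q'.
by rewrite rev_rcons; case: s.
Qed.

Lemma markov_rcons s q : markov_seq (rcons s q) = Cmx S q *m state_markov s.
Proof. by rewrite /markov_seq rev_rcons. Qed.

(** By induction on time: the new input gives the one-letter words, with parameter [Bmx S q], and
    each older word gains a last letter [q], multiplying its parameter by [Amx S q]. *)
Lemma state_at_convolution p u t :
  state_at 0 p u t = \sum_(k < t)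
    (\sum_(v : (t - k).-tuple 'I_D) sched_monomial p k v *: state_markov v)
      *m u k.
Proof.
elim: t => [|t IHt] /=; first by rewrite big_ord0.
rewrite big_ord_recr /= subSnn sum_rcons_monomial addn0.
under eq_bigr do rewrite scalerDr.
rewrite big_split /=; congr (_ + _).
  rewrite IHt; under eq_bigr do rewrite mulmx_sumr scaler_sumr.
  rewrite exchange_big /=; apply: eq_bigr => k _.
  rewrite subSn ?(ltnW (ltn_ord k)) // sum_rcons_monomial.
  rewrite subnKC ?(ltnW (ltn_ord k)) // [RHS]mulmx_suml.
  apply: eq_bigr => q _; rewrite -scalemxAl mulmxA; congr (_ *: (_ *m _)).
  rewrite mulmx_sumr; apply: eq_bigr => v _.
  rewrite -scalemxAr state_markov_rcons.
  (* As [k < t], the word [v] is nonempty, which excludes the [Bmx] branch. *)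
  have := size_tuple v; case: (val v) => // /eqP.
  by rewrite eq_sym subn_eq0 leqNgt ltn_ord.
rewrite mulmx_suml; apply: eq_bigr => q _.
rewrite -scalemxAl (big_pred1 [tuple]) => [|v]; last first.
  by apply/esym/eqP; exact: tuple0.
by rewrite /sched_monomial big_ord0 scale1r state_markov_rcons.
Qed.

(** The readout appends a last letter [q] to the words of the state convolution and multiplies on
    the left by [Cmx S q]. *)
Lemma io_map_gcr : is_gcr (io_map_of S) markov.
Proof.
move=> w; rewrite /io_map_of /output /state state_at_convolution /gcr_eval.
set t := last_time _; set p := sched _.
under eq_bigr do rewrite mulmx_sumr scaler_sumr.
rewrite exchange_big; apply: eq_bigr => k _ /=.
rewrite (sum_rcons_monomial _ _ _ markov_seq) subnKC ?(ltnW (ltn_ord k)) //.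
rewrite [RHS]mulmx_suml; apply: eq_bigr => q _.
rewrite -scalemxAl mulmxA; congr (_ *: (_ *m _)).
rewrite mulmx_sumr; apply: eq_bigr => v _.
by rewrite -scalemxAr markov_rcons.
Qed.

Lemma realizes_markov (f : iomap m r P) K : linspan P = setT -> is_gcr f K ->
  realizes S f <-> K = markov.
Proof.
move=> PT fK; split=> [fS|KS].
  by apply: (is_gcr_inj PT fK); rewrite fS; exact: io_map_gcr.
by apply: funext => w; rewrite fK io_map_gcr KS.
Qed.

Definition step_closed (P' : set 'cV[R]_D) (W : set 'cV[R]_n) : Prop :=
  forall a x b, P' a -> W x -> W (step a x b).

(** For fixed [x] and [b], the values [a] that send [x] into [W] form a subspace containing [P']. *)
Lemma step_closed_span (P' P'' : set 'cV[R]_D) W :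
  linspan P' = setT -> subspace W -> step_closed P' W -> step_closed P'' W.
Proof.
move=> PT [W0 Wlin] WP a x b _ Wx; move: a.
apply: (linspan_ind PT (W := fun a => W (step a x b))) => [|a Pa].
  split=> [|c a a' Wa Wa']; first by rewrite step0.
  by rewrite step_sched_linear; exact: Wlin.
exact: WP.
Qed.

Lemma range_state_sub W : W 0 -> step_closed P W -> range (state 0) `<=` W.
Proof.
move=> W0 WP x /range_stateP[p [u [t [pP ->]]]].
by elim: t => //= t IHt; exact: WP.
Qed.

Lemma step_closed_linspan_state : step_closed P (linspan (range (state 0))).
Proof.
have step_state a x b : P a -> range (state 0) x -> range (state 0) (step a x b).
  move=> Pa /range_stateP[p [u [t [pP ->]]]]; apply/range_stateP.
  exists (fun i => if (i < t)%N then p i else a),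
    (fun i => if (i < t)%N then u i else b), t.+1.
  split=> [i|/=]; first by case: ifP.
  rewrite ltnn; congr (step _ _ _).
  by apply: eq_state_at => i ->.
move=> a x b Pa; have [L0 Llin] := subspace_linspan (range (state (S := S) 0)).
have L_step y c : range (state 0) y -> linspan (range (state 0)) (step a y c).
  by move=> Ry; apply/subset_linspan/step_state.
(* With [b] fixed, a step is only affine in [x]; it is split as [step a x 0 + step a 0 b]. The
   second term starts from 0, reached at time 0, and the first is linear in [x]. *)
have Lb : linspan (range (state 0)) (step a 0 b).
  apply: L_step; apply/range_stateP.
  by exists (fun=> a), (fun=> 0), 0%N.
move=> Lx.
have : linspan (range (state 0)) (step a x 0).
  move: x Lx; apply: (linspan_min (W := fun y => linspan _ (step a y 0))).
    split=> [|c y z Ly Lz].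
      by rewrite step00.
    have := step_linear c a y z 0 0; rewrite scaler0 addr0 => ->.
    exact: Llin.
  by move=> y Ry; exact: L_step.
move=> Lx0; have := step_linear 1 a x 0 0 b.
by rewrite !scale1r addr0 add0r => ->; rewrite -[step a x 0]scale1r; exact: Llin.
Qed.

Definition unobservable (x : 'cV[R]_n) : Prop :=
  forall p t, (forall i, P (p i)) -> readout (p t) (state_at x p (fun=> 0) t) = 0.

(** Under a common input, the difference of the two outputs is the zero-input response from
    [x - x']. *)
Lemma output_eq_unobservable x x' :
  output x = output x' <-> unobservable (x - x').
Proof.
have subE p u t :
    readout (p t) (state_at x p u t) - readout (p t) (state_at x' p u t) =
    readout (p t) (state_at (x - x') p (fun=> 0) t).
  rewrite addrC -scaleN1r -readout_linear -state_at_linear scaleN1r addrC.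
  by congr readout; apply: eq_state_at => // i _; rewrite scaleN1r addNr.
rewrite output_eqP; split=> [xx' p t pP|xx' p u t pP].
  by rewrite -(subE p (fun=> 0)) xx' // subrr.
by apply/eqP; rewrite -subr_eq0 subE xx'.
Qed.

Lemma subspace_unobservable : subspace unobservable.
Proof.
split=> [|c x y xN yN] p t pP.
  transitivity (readout (p t) 0).
    by congr (readout _ _); elim: t => //= t ->; exact: step00.
  by rewrite /readout big1 // => q _; rewrite mulmx0 scaler0.
rewrite -[LHS](_ : readout (p t) (state_at (c *: x + y) p
  (fun i => c *: 0 + 0) t) = _); last first.
  by congr readout; apply: eq_state_at => // i _; rewrite scaler0 addr0.
by rewrite state_at_linear readout_linear xN // yN // scaler0 addr0.
Qed.

(** Scheduling values are freed from the first onwards: an input-free step with a value in [P]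
    preserves unobservability over [P], hence by linearity so does one with any value, and induction
    applies to the new state. *)
Lemma unobservable_span x p t : linspan P = setT -> unobservable x ->
  readout (p t) (state_at x p (fun=> 0) t) = 0.
Proof.
move=> PT; elim: t x p => [|t IHt] x p xN.
  apply: (linspan_ind PT (W := fun a => readout a x = 0)) => [|a Pa].
    split=> [|c a a' ax a'x]; first exact: readout0.
    by rewrite readout_sched_linear ax a'x scaler0 addr0.
  exact: (xN (fun=> a) 0%N).
have [N0 Nlin] := subspace_unobservable.
rewrite state_at_shift; apply: (IHt _ (fun i => p i.+1)).
apply: (linspan_ind PT (W := fun a => unobservable (step a x 0))) => [|a Pa].
  split=> [|c a a' ax a'x]; first by rewrite step0.
  by rewrite step_sched_linear; exact: Nlin.
(* Prepending [a] to [p'] turns a response from the stepped state into one from [x]. *)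
move=> p' t' p'P; have := xN (fun i => if i is i'.+1 then p' i' else a) t'.+1.
by rewrite state_at_shift; apply=> -[].
Qed.

End Responses.

(** * Independence of the spanning scheduling space *)

Section ChangeOfScheduling.
Variables (R : realType) (D m r : nat) (P P' : set 'cV[R]_D).
Hypotheses (PT : linspan P = setT) (P'T : linspan P' = setT).

(** Generalizes [switched] to an arbitrary target, so that one implication serves both directions of
    each equivalence. *)
Definition change_sched (Q Q' : set 'cV[R]_D) (S : alpv m r Q) : alpv m r Q' :=
  ALPV Q' (Amx S) (Bmx S) (Cmx S).

Lemma change_schedK (Q Q' : set 'cV[R]_D) (S : alpv m r Q) :
  change_sched Q (change_sched Q' S) = S.
Proof. by case: S. Qed.

Lemma isomorphic_change_sched (Q Q' : set 'cV[R]_D) (S1 S2 : alpv m r Q) :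
  isomorphic S1 S2 -> isomorphic (change_sched Q' S1) (change_sched Q' S2).
Proof. by case=> n A Aa B Ba C Ca T Tu TS; exact: (Isomorphic _ Tu). Qed.

Lemma reachable_change_sched (S : alpv m r P) :
  reachable S -> reachable (change_sched P' S).
Proof.
rewrite /reachable => Sreach; apply/seteqP; split=> // x _.
set S' := change_sched P' S.
(* The span of the states reachable over [P'] is closed under steps with any scheduling value, so it
   contains the states reachable over [P]. *)
have S'sub := subspace_linspan (range (state (S := S') 0)).
have S'closed :=
  step_closed_span P'T S'sub (@step_closed_linspan_state _ _ _ _ _ S').
apply: (linspan_min S'sub (X := range (state (S := S) 0))); last by rewrite Sreach.
apply: range_state_sub; first by case: S'sub.
exact: S'closed.
Qed.

Lemma observable_change_sched (S : alpv m r P) :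
  observable S -> observable (change_sched P' S).
Proof.
move=> Sobs x1 x2 /output_eq_unobservable xN; apply: Sobs.
apply/output_eq_unobservable => p t _.
exact: (unobservable_span (S := change_sched P' S) p t P'T xN).
Qed.

(** A competitor over [P'] is carried back to [P] with the same dimension; its Markov kernel, equal
    to that of [S], is unchanged. *)
Lemma minimal_change_sched (S : alpv m r P) :
  minimal S -> minimal (change_sched P' S).
Proof.
move=> Smin S' S'real; apply: (Smin (change_sched P S')).
have /(realizes_markov _ P'T) := io_map_gcr (change_sched P' S).
move=> /(_ S')[/(_ S'real) SS' _].
by apply/(realizes_markov _ PT (io_map_gcr S)).
Qed.

End ChangeOfScheduling.

Lemma switched_io_gcr (R : realType) (D m r : nat) (P : set 'cV[R]_D)
  (f : iomap m r P) (fP : admits_gcr f) :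
  is_gcr (switched_io fP) (kernel_of fP).
Proof. by []. Qed.

Theorem theorem1 (R : realType) (D m r : nat)
    (D_gt0 : (0 < D)%N) (m_gt0 : (0 < m)%N) (r_gt0 : (0 < r)%N)
    (P : set 'cV[R]_D) (P_span : linspan P = setT) :
  [/\ forall (f : iomap m r P) (fP : admits_gcr f) (S : alpv m r P),
        realizes S f <-> realizes (switched S) (switched_io fP),
      forall S : alpv m r P, alpv_dim (switched S) = alpv_dim S,
      forall S1 S2 : alpv m r P,
        isomorphic S1 S2 <-> isomorphic (switched S1) (switched S2)
    & forall S : alpv m r P,
        [/\ reachable S <-> reachable (switched S),
            observable S <-> observable (switched S)
          & minimal S <-> minimal (switched S)]].
Proof.
have sw_span := linspan_Psw R D.
split=> [f fP S|//|S1 S2|S].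
- have fK : is_gcr f (kernel_of fP) by rewrite /kernel_of; case: cid.
  rewrite (realizes_markov S P_span fK).
  by rewrite (realizes_markov (switched S) sw_span (switched_io_gcr fP)).
- split; first exact: isomorphic_change_sched.
  by move/(isomorphic_change_sched P); rewrite !change_schedK.
(* Writing [S] as its own round trip through [Psw] makes the converse implications instances of the
   same lemmas. *)
rewrite -{2 4 6}[S](change_schedK (@Psw R D)).
split; split.
- exact: reachable_change_sched.
- exact: reachable_change_sched.
- exact: observable_change_sched.
- exact: observable_change_sched.
- exact: minimal_change_sched.
- exact: minimal_change_sched.
Qed.
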